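(* Let $M$ be a map and $G$ a finite group whose irreducible complex representations have dimensions $n_1,\dots,n_\ell$. Then the number of nowhere-identity local $G$-tensions of $M$ equals $$(-1)^{e(M)-f(M)}\mathcal T(M;\mathbf x,\mathbf y)\quad\text{evaluated at } x=-|G|,\ y=1,\ x_g=-\frac{1}{|G|}\sum_{i=1}^\ell n_i^{2-2g},\ y_g=1\ (g=0,1,2,\dots),$$ and the number of nowhere-identity local $G$-flows of $M$ equals $$(-1)^{e(M)-v(M)}\mathcal T(M;\mathbf x,\mathbf y)\quad\text{evaluated at } x=1,\ y=-|G|,\ x_g=1,\ y_g=-\frac{1}{|G|}\sum_{i=1}^\ell n_i^{2-2g}\ (g=0,1,2,\dots).$$
   Context: A connected map is a 2-cell embedding of a finite connected graph (loops and multiple edges allowed) in a closed connected oriented surface (equivalently a connected graph with a rotation system). A map is a finite disjoint union of connected maps, each in its own surface. For a map $M$: $v(M),e(M),k(M)$ are the numbers of vertices, edges, components; $f(M)$ total number of faces; $g(M)$ sum of genera of components; $n(M)=e(M)-v(M)+k(M)$, $n^*(M)=e(M)-f(M)+k(M)$. Deletion $M\backslash e$ removes $e$ from the rotation system (same vertex set; resulting components regarded as their own maps); contraction is $M/e=(M^*\backslash e^* )^*$ with $M^*$ the componentwise surface dual. For $A\subseteq E$, $A^c=E\setminus A$. The surface Tutte polynomial in commuting indeterminates $\mathbf x=(x,x_0,x_1,\dots)$, $\mathbf y=(y,y_0,y_1,\dots)$ is $$\mathcal T(M;\mathbf x,\mathbf y)=\sum_{A\subseteq E}x^{n^*(M/A)}y^{n(M\backslash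 A^c)}\prod_{\text{components }M_i\text{ of }M/A}x_{g(M_i)}\prod_{\text{components }M_j\text{ of }M\backslash A^c}y_{g(M_j)}.$$ Fix an arbitrary orientation of the edges of $M$. A nowhere-identity local $G$-tension is an assignment of non-identity elements of $G$ to the edges such that for each face, the product of the values on its boundary edges taken in the anticlockwise cyclic order of traversal of the face, with the value inverted on edges traversed against their orientation, equals the identity. A nowhere-identity local $G$-flow is an assignment of non-identity elements of $G$ to the edges such that at each vertex the product of the values of the incident edge-ends taken in the anticlockwise cyclic (rotation) order around the vertex, with the value inverted on edge-ends where the edge is incoming, equals the identity (a loop contributes twice, once as outgoing and once as incoming). These counts do not depend on the chosen orientation. *)

(* Defs.v *)
From HB Require Import structures.
From mathcomp Require Import all_boot all_order all_algebra all_fingroup.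
From mathcomp Require Import all_solvable all_field all_character.
From mathcomp Require Import finmap monalg.

Set Implicit Arguments.
Unset Strict Implicit.
Unset Printing Implicit Defensive.

Import Order.TTheory GRing.Theory Num.Theory.

(* A (not necessarily connected) map, as a graph with a rotation system.  The
   darts, or edge-ends, of an edge e are (e, false) and (e, true); a dart sits
   at a vertex and points away from it along its edge.  [vertex_perm] sends a
   dart to the next one anticlockwise around its vertex, so that the vertices
   carrying at least one edge are the cycles of [vertex_perm].  An edgeless
   vertex has no dart to represent it; it is a component by itself (a point on
   a sphere, with one face), and only the number of such vertices is
   recorded. *)
Record surface_map := SurfaceMap {
  edge : finType;
  vertex_perm : {perm edge * bool};
  isolated : nat
}.

Notation dart M := (edge M * bool)%type.

Section Invariants.
Variable M : surface_map.

Definition opp_dart (d : dart M) : dart M := (d.1, ~~ d.2).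

Lemma opp_dartK : involutive opp_dart.
Proof. by case=> e b; rewrite /opp_dart /= negbK. Qed.

Definition edge_perm : {perm dart M} := perm (inv_inj opp_dartK).

(* Traversing a face anticlockwise keeps it on the left: having followed d to
   its head, where the dart [edge_perm d] sits, one leaves along the next dart
   clockwise.  Thus [face_perm d] is [(vertex_perm M)^-1 (edge_perm d)]. *)
Definition face_perm : {perm dart M} := (edge_perm * (vertex_perm M)^-1)%g.

Definition components : {set {set dart M}} :=
  [set orbit 'P%act <<[set vertex_perm M; edge_perm]>>%g d | d : dart M].

Definition n_edges : nat := #|edge M|.
Definition n_vertices : nat := #|porbits (vertex_perm M)| + isolated M.
Definition n_faces : nat := #|porbits face_perm| + isolated M.
Definition n_components : nat := #|components| + isolated M.

(* The subtractions do not truncate: a graph has at least as many edges as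
   vertices minus components, and likewise for the dual graph. *)
Definition nullity : nat := n_edges + n_components - n_vertices.
Definition dual_nullity : nat := n_edges + n_components - n_faces.

(* Genus of the component with dart set C, from Euler's formula
   v - e + f = 2 - 2g. *)
Definition component_genus (C : {set dart M}) : nat :=
  let v := #|[set O in porbits (vertex_perm M) | O \subset C]| in
  let e := #|[set d.1 | d in C]| in
  let f := #|[set O in porbits face_perm | O \subset C]| in
  (e + 2 - (v + f))./2.

End Invariants.

(* The dual edge of e is again named e. Its dart (e, b) sits in the face on the
   left of the dart (e, b) of M, and the darts in a face are met in the
   anticlockwise order of traversal of that face. *)
Definition dual (M : surface_map) : surface_map :=
  SurfaceMap (face_perm M) (isolated M).

Section Deletion.
Variables (M : surface_map) (A : {set edge M}).

Definition kept_edge : finType := {e : edge M | e \notin A}.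

Definition to_dart (d : kept_edge * bool) : dart M := (val d.1, d.2).

Definition of_dart (d : dart M) : option (kept_edge * bool) :=
  omap (fun e => (e, d.2)) (insub d.1).

Lemma to_dartK : pcancel to_dart of_dart.
Proof. by case=> e b; rewrite /of_dart /= valK. Qed.

Lemma of_dartK : ocancel of_dart to_dart.
Proof. by case=> e b; rewrite /of_dart /=; case: insubP => //= u _ <-. Qed.

(* The first kept dart met after d when turning around its vertex;
   [fingraph.orbit s x] is the list x, s x, s (s x), ... of length the order
   of x. *)
Definition kept_perm_fun (d : kept_edge * bool) : kept_edge * bool :=
  let s := vertex_perm M in
  head d (pmap of_dart (fingraph.orbit s (s (to_dart d)))).

Lemma kept_perm_funP d : exists2 i,
  to_dart (kept_perm_fun d) = iter i.+1 (vertex_perm M) (to_dart d) &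
  forall j, j < i -> of_dart (iter j.+1 (vertex_perm M) (to_dart d)) = None.
Proof.
have sI : injective (vertex_perm M) := @perm_inj _ (vertex_perm M).
rewrite /kept_perm_fun; set x := to_dart d; set s := vertex_perm M.
have hx : x \in fingraph.orbit s (s x).
  by rewrite -fconnect_orbit fconnect_sym // fconnect1.
have : has of_dart (fingraph.orbit s (s x)).
  by apply/hasP; exists x => //; rewrite to_dartK.
rewrite /fingraph.orbit; move: (fingraph.order _ _) => n {hx}.
move: (x) => y; move: n y.
elim=> [//|n IHn] y /=.
case Ey: (of_dart (s y)) => [d'|] /= h.
  by exists 0%N => //=; move: (of_dartK (s y)); rewrite Ey.
have [i Ei Hi] := IHn _ h; exists i.+1; first by rewrite Ei -iterSr.
by case=> [|j] //= lt_ji; rewrite -iterS iterSr; apply: Hi.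
Qed.

Lemma kept_perm_fun_inj : injective kept_perm_fun.
Proof.
move=> d1 d2 eq12.
have [i Ei Hi] := kept_perm_funP d1; have [j Ej Hj] := kept_perm_funP d2.
move: Ej; rewrite -eq12 Ei.
wlog le_ij : d1 d2 i j eq12 Ei Hi Hj / i <= j.
  move=> W; case: (leqP i j) => [|/ltnW] le E; first exact: (W _ _ i j).
  by apply/esym/(W d2 d1 j i) => //; rewrite -eq12 Ei.
have -> : j.+1 = (i.+1 + (j - i))%N by rewrite addSn subnKC.
have itI n : injective (iter n (vertex_perm M)).
  by elim: n => //= n IHn x y /perm_inj/IHn.
rewrite iterD => /itI.
case Eji: (j - i)%N => [|k] Ed.
  by apply: Some_inj; rewrite -(to_dartK d1) Ed to_dartK.
have lt_kj : k < j by rewrite -Eji leq_subr.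
by have := Hj k lt_kj; rewrite -Ed to_dartK.
Qed.

Definition kept_perm : {perm kept_edge * bool} := perm kept_perm_fun_inj.

(* The vertices all of whose edges are deleted become isolated. *)
Definition delete : surface_map :=
  SurfaceMap kept_perm
    (isolated M +
     #|[set O in porbits (vertex_perm M) | O \subset [set d | d.1 \in A]]|).

End Deletion.

(* Dualizing twice gives back the map only up to exchanging the two darts of
   each edge, a renaming that affects none of the invariants. *)
Definition contract (M : surface_map) (A : {set edge M}) : surface_map :=
  dual (@delete (dual M) A).

Local Open Scope ring_scope.

(* Indeterminates: [inl None], [inl (Some g)], [inr None], [inr (Some g)] stand
   for x, x_g, y, y_g. *)
Notation indet := (option nat + option nat)%type.

Notation tutte_ring := {malg int[{cmonom indet}]}.

Definition indeterminate (i : indet) : tutte_ring := << ucm i >>.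

Notation varx := (indeterminate (inl None)).
Notation varxg g := (indeterminate (inl (Some g))).
Notation vary := (indeterminate (inr None)).
Notation varyg g := (indeterminate (inr (Some g))).

(* The product over all components of M of the indeterminate z of their genus;
   isolated vertices have genus 0. *)
Definition genus_product (R : comNzRingType) (z : nat -> R) (M : surface_map) :=
  z 0%N ^+ isolated M * \prod_(C in components M) z (component_genus C).

Definition surface_tutte (M : surface_map) : tutte_ring :=
  \sum_(A : {set edge M})
    varx ^+ dual_nullity (contract A) * vary ^+ nullity (delete (~: A)) *
    genus_product (fun g => varxg g) (contract A) *
    genus_product (fun g => varyg g) (delete (~: A)).

Definition valuation (R : comNzRingType) (x y : R) (xg yg : nat -> R)
    (i : indet) : R :=
  match i with
  | inl None => x
  | inl (Some g) => xg g
  | inr None => y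
  | inr (Some g) => yg g
  end.

Section Evaluation.
Variables (R : comNzRingType) (v : indet -> R).

Definition eval_monom (m : {cmonom indet}) : R :=
  \prod_(i <- finsupp m) v i ^+ m i.

Lemma eval_monom_mmorphism : mmorphism eval_monom.
Proof.
have ew (d : {fset indet}) (m : {cmonom indet}) : (finsupp m `<=` d)%fset ->
    eval_monom m = \prod_(i <- d) v i ^+ m i.
  move=> le; rewrite /eval_monom (big_fset_incl _ le) //.
  by move=> i _; rewrite -cmE_eq0 => /eqP ->.
split=> [m1 m2|]; last by rewrite /eval_monom mdom1 big_seq_fset0.
rewrite (ew _ m1 (fsubsetUl _ (finsupp m2))).
rewrite (ew _ m2 (fsubsetUr (finsupp m1) _)) /eval_monom mdomD -big_split /=.
by apply: eq_bigr => i _; rewrite cmM exprD.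
Qed.

HB.instance Definition _ :=
  isMultiplicative.Build {cmonom indet} R eval_monom eval_monom_mmorphism.

Definition eval : tutte_ring -> R := mmap (intr : int -> R) eval_monom.

HB.instance Definition _ := GRing.RMorphism.on eval.

Lemma eval_indeterminate i : eval (indeterminate i) = v i.
Proof.
rewrite /eval /indeterminate mmapU /= mulr1z mul1r.
by rewrite /eval_monom mdomU big_seq_fset1 cmUU expr1.
Qed.

End Evaluation.

Section LocalTensionsAndFlows.
Variables (M : surface_map) (gT : finGroupType) (G : {group gT}).
Variables (o : edge M -> bool) (a : {ffun edge M -> gT}).

(* The edge e is oriented along its dart (e, o e). *)
Definition dart_value (d : dart M) : gT :=
  if d.2 == o d.1 then a d.1 else (a d.1)^-1%g.

Definition nowhere_identity : bool := [forall e, a e \in G^#%g].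

(* [d] is an arbitrary starting point on the face, respectively at the
   vertex. *)
Definition local_tension : bool :=
  [forall d, (\prod_(c <- fingraph.orbit (face_perm M) d) dart_value c == 1)%g].

Definition local_flow : bool :=
  [forall d, (\prod_(c <- fingraph.orbit (vertex_perm M) d) dart_value c == 1)%g].

End LocalTensionsAndFlows.

Definition n_tensions (M : surface_map) (gT : finGroupType) (G : {group gT})
    (o : edge M -> bool) : nat :=
  #|[set a : {ffun edge M -> gT} | nowhere_identity G a && local_tension o a]|.

Definition n_flows (M : surface_map) (gT : finGroupType) (G : {group gT})
    (o : edge M -> bool) : nat :=
  #|[set a : {ffun edge M -> gT} | nowhere_identity G a && local_flow o a]|.

(* The dimensions n_1, ..., n_l of the irreducible complex representations
   ['Chi_i] of G. *)
Definition irr_dim (gT : finGroupType) (G : {group gT}) (i : Iirr G) : nat :=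
  irr_degree (socle_of_Iirr i).

Definition genus_weight (gT : finGroupType) (G : {group gT}) (g : nat) : algC :=
  - (#|G|%:R^-1 * \sum_(i : Iirr G) (irr_dim i)%:R ^ (2 - 2 * g%:Z)).

(* Main.v *)
(* By inclusion-exclusion, the number of nowhere-identity flows of M is the
   alternating sum over A of the numbers of all flows of M \ A^c, so that the
   formula for flows says that a map with vertex permutation s has
   |G|^(e - v) * prod_C sum_i n_i^(2 - 2 g(C)) flows, C ranging over components.
   Dart values x form a flow iff x d = h(d)^-1 h(s d) for some h : darts -> G,
   and then there are |G|^v' such h, with v' the number of cycles of s.  Hence
   one counts the h with h(d)^-1 h(s d) h(d')^-1 h(s d') = 1 for every edge with
   darts d, d'.  Expand these conditions in matrix entries of the irreducible
   representations, with two matrix indices t(d), w(d) for each dart.  Summing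
   over each h(d), Schur orthogonality makes w constant around vertices, t
   constant around faces and the representation constant on components, and a
   component contributes sum_i n_i^(v - e + f).

   That v - e + f = 2 - 2g for a natural number g follows by multiplying s^-1 by
   the transpositions of the edges one at a time, which ends with the face
   permutation.

   Local tensions are by definition local flows of the dual map. *)

Require Import Defs.
From mathcomp Require Import all_boot all_order all_algebra all_fingroup.
From mathcomp Require Import all_solvable all_field all_character.
From mathcomp Require Import finmap monalg zify ring.

Set Implicit Arguments.
Unset Strict Implicit.
Unset Printing Implicit Defensive.

Import Order.TTheory GRing.Theory Num.Theory.
Local Open Scope ring_scope.

Section IrreducibleMatrixEntries.

Variables (gT : finGroupType) (G : {group gT}).
Implicit Types (i j : Iirr G) (a b : gT).

Let cardG_neq0 : #|G|%:R != 0 :> algC. Proof. exact: neq0CG. Qed.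

Lemma irr_dim_gt0 i : (0 < irr_dim i)%N.
Proof. exact: irr_degree_gt0. Qed.

Lemma irr_dim_neq0 i : (irr_dim i)%:R != 0 :> algC.
Proof. by rewrite pnatr_eq0 -lt0n irr_dim_gt0. Qed.

Lemma Schur_intertwiner i j (X : 'M[algC]_(irr_dim i, irr_dim j)) :
    {in G, forall a, 'Chi_i a *m X = X *m 'Chi_j a} ->
  i != j -> X = 0.
Proof.
move=> cX neq_ij; set W := @socle_of_Iirr gT G; set e := Wedderburn_id (W i).
have pG := algC'G_pchar G.
have op_e k : gring_op 'Chi_k e = \sum_(a in G)
    (#|G|%:R^-1 * ('chi_i 1%g * 'chi_i a^-1%g)) *: 'Chi_k a.
  rewrite /e [X in gring_op _ X]Wedderburn_id_expansion linearZ linear_sum /=.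
  rewrite scaler_sumr.
  by apply: eq_bigr => a Ga; rewrite linearZ /= gring_opG // scalerA.
have := op_Wedderburn_id_pchar pG (W i); rewrite -/e op_e => e1.
have neqW : W i != W j.
  by apply: contraNneq neq_ij => /(can_inj (@socle_of_IirrK _ _))->.
have := irr_repr'_op0_pchar pG neqW (Wedderburn_id_mem (W i)).
rewrite -/e op_e => e0.
rewrite -[X]mul1mx -e1 mulmx_suml.
rewrite -[RHS](mulmx0 _ X) -e0 mulmx_sumr; apply: eq_bigr => a Ga.
by rewrite -scalemxAl -scalemxAr cX.
Qed.

Lemma Schur_scalar i (X : 'M[algC]_(irr_dim i)) :
    {in G, forall a, 'Chi_i a *m X = X *m 'Chi_i a} -> is_scalar_mx X.
Proof.
move=> cX; apply: (mx_abs_irr_cent_scalar (rG := 'Chi_i)).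
  exact/groupC/socle_irr.
by apply/centgmxP => a Ga; rewrite cX.
Qed.

Lemma conj_sum_intertwines m n (rG : mx_representation algC G m)
    (rG' : mx_representation algC G n) (Y : 'M_(m, n)) :
  let X := \sum_(a in G) rG a^-1%g *m Y *m rG' a in
  {in G, forall a, rG a *m X = X *m rG' a}.
Proof.
move=> X a Ga; rewrite mulmx_sumr mulmx_suml.
rewrite (reindex_inj (mulIg a)); apply: eq_big => b; rewrite groupMr // => Gb.
by rewrite !mulmxA -repr_mxM ?groupV ?groupM //
  invMg mulKVg -[RHS]mulmxA -repr_mxM.
Qed.

Lemma Schur_entries i j p q r s :
  \sum_(a in G) 'Chi_i a^-1%g p q * 'Chi_j a r s =
  (#|G|%:R / (irr_dim i)%:R) *
    ((Tagged (fun i => 'I_(irr_dim i)) p == Tagged _ s) &&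
     (Tagged (fun i => 'I_(irr_dim i)) q == Tagged _ r))%:R.
Proof.
pose X : 'M[algC]_(irr_dim i, irr_dim j) :=
  \sum_(a in G) 'Chi_i a^-1%g *m delta_mx q r *m 'Chi_j a.
have -> : \sum_(a in G) 'Chi_i a^-1%g p q * 'Chi_j a r s = X p s.
  rewrite summxE; apply: eq_bigr => a _.
  move: ('Chi_i _) ('Chi_j _) => A B; rewrite -mulmxA mxE.
  rewrite (bigD1 q) //= big1 ?addr0 => [|k neq_k].
    rewrite mxE (bigD1 r) //= big1 ?addr0 ?mxE ?eqxx ?mul1r // => k neq_k.
    by rewrite mxE (negPf neq_k) andbF mul0r.
  by rewrite mxE big1 ?mulr0 // => l _; rewrite mxE (negPf neq_k) mul0r.
have cX := conj_sum_intertwines 'Chi_i 'Chi_j (delta_mx q r); rewrite -/X in cX.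
case: (eqVneq i j) => [eq_ij | neq_ij]; last first.
  by rewrite (Schur_intertwiner cX neq_ij) mxE -tag_eqE /tag_eq /=
    (negPf neq_ij) mulr0.
subst j; rewrite !eq_Tagged /=.
case/is_scalar_mxP: (Schur_scalar cX) => c defX.
have := congr1 mxtrace defX; rewrite mxtrace_scalar linear_sum /=.
under eq_bigr => a Ga do
  rewrite mxtrace_mulC mulmxA -repr_mxM ?groupV // mulgV repr_mx1 mul1mx.
rewrite sumr_const -[RHS]mulr_natr => trX; rewrite defX mxE.
have -> : c = #|G|%:R / (irr_dim i)%:R * (q == r)%:R.
  apply: (mulIf (irr_dim_neq0 i));
    rewrite /= -trX mulrAC divfK ?irr_dim_neq0 //.
  rewrite mulr_natl /mxtrace (bigD1 q) //= big1 ?addr0 ?mxE ?eqxx //= =>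
    k neq_k.
  by rewrite mxE (negPf neq_k).
by case: (p == s); rewrite /= ?mulr1n ?mulr0.
Qed.

Notation irr_index := {i : Iirr G & 'I_(irr_dim i)}.
Notation ix p := (Tagged (fun i : Iirr G => 'I_(irr_dim i)) p).

Lemma sum_irr_index (F : irr_index -> algC) :
  \sum_P F P = \sum_i \sum_(p < irr_dim i) F (ix p).
Proof.
rewrite (sig_big_dep xpredT (fun _ => xpredT) (fun i (p : 'I_(irr_dim i)) =>
  F (ix p))).
by apply: eq_bigr => -[].
Qed.

(* The (P, Q) entry of the direct sum of all the irreducible representations,
   whose rows and columns are indexed by the sum of the index sets. *)
Definition irr_entry a (P Q : irr_index) : algC :=
  (tag P == tag Q)%:R * 'Chi_(tag P) a (tagged P) (tagged_as P Q).

Lemma irr_entryE a i p q :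
  irr_entry a (ix p) (ix q) = 'Chi_i a p q.
Proof. by rewrite /irr_entry tagged_asE /= eqxx mul1r. Qed.

Lemma irr_entryM a b P S : a \in G -> b \in G ->
  \sum_Q irr_entry a P Q * irr_entry b Q S = irr_entry (a * b) P S.
Proof.
case: P S => [i p] [j s] Ga Gb.
rewrite sum_irr_index (bigD1 i) //= [X in _ + X]big1 ?addr0 => [|k neq_ki];
  last first.
  by apply: big1 => q _; rewrite /irr_entry /= eq_sym (negPf neq_ki) !mul0r.
case: (eqVneq i j) => [eq_ij | neq_ij]; last first.
  rewrite [in RHS]/irr_entry /= (negPf neq_ij) mul0r; apply: big1 => q _.
  by rewrite mulrC /irr_entry /= (negPf neq_ij) !mul0r.
subst j; rewrite irr_entryE repr_mxM // mxE.
by apply: eq_bigr => q _; rewrite !irr_entryE.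
Qed.

Lemma irr_entry_Schur P Q S U :
  \sum_(a in G) irr_entry a^-1%g P Q * irr_entry a S U =
  #|G|%:R / (irr_dim (tag P))%:R *
    [&& P == U, Q == S & tag P == tag Q]%:R.
Proof.
case: P Q S U => [i p] [i' q] [j r] [j' s] /=.
case: (eqVneq i i') => [eq_i | neq_i]; last first.
  rewrite !andbF mulr0 big1 // => a _; rewrite /irr_entry /= (negPf neq_i).
  by rewrite !mul0r.
subst i'; rewrite andbT.
case: (eqVneq j j') => [eq_j | neq_j].
  subst j'; rewrite -(Schur_entries p q r s); apply: eq_bigr => a _.
  by rewrite !irr_entryE.
rewrite big1 => [|a _]; last by rewrite /irr_entry /= (negPf neq_j) mul0r mulr0.
rewrite (_ : _ && _ = false) ?mulr0 //; apply: contraNF neq_j.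
by move=> /andP[/eqP/(congr1 tag)/= <- /eqP/(congr1 tag)/= <-].
Qed.

Lemma irr_entry_delta a : a \in G ->
  (a == 1%g)%:R =
  #|G|%:R^-1 * \sum_P (irr_dim (tag P))%:R * irr_entry a P P :> algC.
Proof.
move=> Ga; apply: (mulfI cardG_neq0); rewrite mulVKf //.
have /cfunP/(_ a) := cfReg_sum G; rewrite cfRegE mulr_natr => ->.
rewrite sum_cfunE sum_irr_index.
apply: eq_bigr => i _; rewrite cfunE -irrRepr cfRepr1 cfunE Ga mulr1n.
by rewrite /mxtrace mulr_sumr; apply: eq_bigr => p _; rewrite irr_entryE.
Qed.

End IrreducibleMatrixEntries.

Notation irr_index G := {i : Iirr G & 'I_(irr_dim i)}.

Section FactoringFunctions.

Variables (T K I : finType) (q : T -> K) (i0 : I).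

Lemma big_factor (R : Type) (idx : R) (op : Monoid.com_law idx)
    (P : pred {ffun T -> I}) (W : {ffun T -> I} -> R) :
    (forall f : {ffun T -> I}, reflect (forall x y, q x = q y -> f x =
      f y) (P f)) ->
  \big[op/idx]_(f | P f) W f =
  \big[op/idx]_(g in pffun_on i0 (mem (q @: T)) predT) W [ffun x => g (q x)].
Proof.
move=> PP.
pose down (f : {ffun T -> I}) :=
  [ffun k => if [pick x | q x == k] is Some x then f x else i0].
rewrite (reindex_onto (fun g : {ffun K -> I} => [ffun x => g (q x)]) down).
  apply: eq_bigl => g.
  have -> : P [ffun x => g (q x)].
    by apply/PP => x y eq_q; rewrite !ffunE eq_q.
  apply/eqP/pffun_onP => [<- | [g_supp _]].
    split=> [|y _ //]; apply/subsetP => k; rewrite inE ffunE;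
      case: pickP => [x /eqP <- _|_ /eqP//].
    exact: imset_f.
  apply/ffunP => k; rewrite ffunE; case: pickP => [x /eqP <-|no_x].
    by rewrite ffunE.
  apply/esym/eqP; apply: contraT => /(subsetP g_supp).
  by case/imsetP=> x _ /esym/eqP; rewrite no_x.
move=> f /PP fP; apply/ffunP => x; rewrite !ffunE.
by case: pickP => [y /eqP/fP // | /(_ x)]; rewrite eqxx.
Qed.

Lemma sum_factor (R : comPzSemiRingType) (P : pred {ffun T -> I})
    (W : {ffun T -> I} -> R) (H : K -> I -> R) :
    (forall f : {ffun T -> I}, reflect (forall x y, q x = q y -> f x =
      f y) (P f)) ->
    (forall g : {ffun K -> I},
      W [ffun x => g (q x)] = \prod_(k in q @: T) H k (g k)) ->
  \sum_(f | P f) W f = \prod_(k in q @: T) \sum_i H k i.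
Proof.
move=> PP WH; rewrite (big_factor _ _ PP) (big_distr_big i0).
by apply: eq_bigr => g _; rewrite WH.
Qed.

End FactoringFunctions.

Section PermutationOrbits.

Variable T : finType.
Implicit Types (s t : {perm T}) (A : {set {perm T}}).

Lemma orbit_invariantP A (I : eqType) (f : T -> I) :
  (forall x y, orbit 'P%act <<A>>%g x = orbit 'P%act <<A>>%g y -> f x = f y) <->
  {in A, forall s x, f (s x) = f x}.
Proof.
split=> [fA s As x | fA x y /orbit_eqP/orbitP[s + <-]].
  by apply: fA; apply/orbit_eqP; rewrite (mem_orbit 'P x) // mem_gen.
rewrite /= apermE => /gen_prodgP[n [c cA ->]].
elim/big_rec: _ y => [|k u _ IHu] y; first by rewrite perm1.
by rewrite permM IHu fA.
Qed.

Lemma porbit_invariantP s (I : finType) (f : {ffun T -> I}) :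
  reflect (forall x y, porbit s x = porbit s y -> f x = f y)
          [forall x, f (s x) == f x].
Proof.
have E := @orbit_invariantP [set s] _ f.
apply: (iffP forallP) => [fs x y | fs x].
  rewrite !porbitE; apply: E.2 => _ /set1P-> z; exact/eqP/fs.
by apply/eqP/E.1; rewrite ?set11 // => y z; have := fs y z; rewrite !porbitE.
Qed.

Lemma porbits_tperm_mul_invariant s x y (n := #|porbits s|) :
  x != y ->
  #|porbits (tperm x y * s)| = if x \in porbit s y then n.+1 else n.-1.
Proof.
have := porbits_mul_tperm s x y => /= + ne_xy; rewrite ne_xy.
case: ifP => _ /=; first by rewrite addn0 addn1.
by rewrite addn2 addn1 => -[/(congr1 predn)].
Qed.

Definition mul_tperms s (ps : seq (T * T)) : {perm T} :=
  foldr (fun p u => tperm p.1 p.2 * u)%g s ps.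

Definition stable_under s (ps : seq (T * T)) : {set {ffun T -> bool}} :=
  [set f : {ffun T -> bool} |
    [forall x, f (s x) == f x] && all (fun p => f p.1 == f p.2) ps].

Lemma stable_mul_tperms s ps f :
  f \in stable_under s ps -> [forall x, f (mul_tperms s ps x) == f x].
Proof.
rewrite inE => /andP[fs]; elim: ps => //= p ps IHps /andP[fp /IHps/forallP fps].
apply/forallP => x; rewrite permM (eqP (fps _)).
by case: tpermP => [->|->|_ _] //; rewrite eq_sym.
Qed.

Lemma stable_halving s p ps :
  (#|stable_under s ps| <= 2 * #|stable_under s (p :: ps)|)%N.
Proof.
rewrite -(cardsID [set f : {ffun T -> bool} | f p.1 == f p.2]) mul2n -addnn.
have -> : stable_under s ps :&: [set f : {ffun T -> bool} | f p.1 == f p.2] =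
    stable_under s (p :: ps).
  by apply/setP => f; rewrite !inE /= -andbA; congr (_ && _); apply: andbC.
rewrite leq_add2l.
set bad := _ :\: _; have [->|[f0 bad_f0]] := set_0Vmem bad;
  first by rewrite cards0.
pose flip (f : {ffun T -> bool}) := [ffun x => f x (+) f0 x].
have flipK : cancel flip flip.
  by move=> f; apply/ffunP => x; rewrite !ffunE addbK.
rewrite -(card_imset bad (can_inj flipK));
  apply/subset_leq_card/subsetP => _ /imsetP[f bad_f ->].
move: bad_f0 bad_f; rewrite !inE /= =>
  /and3P[p0 /forallP s0 ps0] /and3P[pf /forallP sf psf].
rewrite !ffunE; apply/and3P; split.
- by apply/forallP => x; rewrite !ffunE (eqP (s0 x)) (eqP (sf x)).
- by move: p0 pf; case: (f0 p.1); case: (f0 p.2); case: (f p.1); case: (f p.2).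
- apply/allP => r r_ps; rewrite !ffunE.
  by rewrite (eqP (allP ps0 r r_ps)) (eqP (allP psf r r_ps)).
Qed.

(* A transposition that splits a cycle does not affect the stable functions; one
   that merges two cycles at most halves their number. *)
Lemma mul_tperms_cycles s ps (t := mul_tperms s ps) :
    all (fun p => p.1 != p.2) ps ->
  (2 ^ (#|porbits t| + #|porbits s|) <=
     2 ^ size ps * #|stable_under s ps| ^ 2)%N /\
  ~~ odd (#|porbits t| + #|porbits s| + size ps)%N.
Proof.
rewrite {}/t; elim: ps => [_|p ps IHps] /=.
  rewrite addn0 oddD addbb; split=> //.
  rewrite addnn -mul2n mulnC expnM mul1n leq_exp2r //.
  have -> : stable_under s [::] =
    [set f : {ffun T -> bool} | [forall x, f (s x) == f x]].
    by apply/setP => f; rewrite !inE andbT.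
  rewrite -sum1dep_card (big_factor true _ _ (@porbit_invariantP s _)) sum1_card
    card_pffun_on card_bool.
  by rewrite leq_eqVlt eqxx.
case/andP=> ne_p /IHps[le_ps odd_ps];
  set u := mul_tperms s ps in le_ps odd_ps *.
rewrite porbits_tperm_mul_invariant //.
have [in_p | notin_p] := ifPn; split.
- rewrite addSn !(expnS 2) -mulnA leq_mul2l /=; apply: leq_trans le_ps _.
  rewrite leq_mul2l; apply/orP; right; rewrite leq_exp2r //.
  apply/subset_leq_card/subsetP => f f_ps; have := stable_mul_tperms f_ps.
  rewrite -/u => /porbit_invariantP fu; move: f_ps;
    rewrite !inE /= => /andP[-> ->].
  by rewrite andbT; apply/eqP/fu/eqP; rewrite eq_porbit_mem.
- by rewrite addSn addSn addnS /= negbK.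
- have: (0 < #|porbits u|)%N by apply/card_gt0P; exists (porbit u p.1);
  apply: imset_f.
  case: #|porbits u| le_ps => // n; rewrite addSn /= => le_ps _.
  have := stable_halving s p ps; rewrite -leq_sqr expnMn => le_S.
  rewrite -(@leq_pmul2l 2) // -expnS; apply: leq_trans le_ps _.
  rewrite mulnA -expnS -(addn2 (size ps)) expnD -mulnA leq_mul2l; apply/orP;
    right.
  exact: le_S.
- have: (0 < #|porbits u|)%N by apply/card_gt0P; exists (porbit u p.1);
  apply: imset_f.
  case: #|porbits u| odd_ps => // n; rewrite addSn /=.
  by rewrite addnS /= !negbK.
Qed.

End PermutationOrbits.

Section Components.

Variable M : surface_map.
Notation s := (vertex_perm M).
Notation alpha := (edge_perm M).
Notation phi := (face_perm M).
Implicit Types (d : dart M) (C : {set dart M}) (t : {perm dart M}).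

Definition component_of d : {set dart M} :=
  orbit 'P%act <<[set s; alpha]>>%g d.

Definition cycles_in t (C : {set dart M}) := [set O in porbits t | O \subset C].
Definition edges_of C : {set edge M} := [set d.1 | d in C].

Lemma edge_permE d : alpha d = (d.1, ~~ d.2).
Proof. by rewrite permE. Qed.

Lemma edge_permK : involutive alpha.
Proof. by move=> d; rewrite !edge_permE /= negbK; case: d. Qed.

Lemma face_permE d : phi d = (s^-1)%g (alpha d).
Proof. by rewrite permM. Qed.

Lemma componentP (I : eqType) (f : dart M -> I) :
  (forall x y, component_of x = component_of y -> f x = f y) <->
  (forall d, f (s d) = f d) /\ (forall d, f (alpha d) = f d).
Proof.
apply: iff_trans (orbit_invariantP _ _) _; split=> [fI | [fs fa] t].
  by split=> d; apply: fI; rewrite !inE eqxx ?orbT.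
by case/set2P=> ->.
Qed.

Lemma component_of_vertex d : component_of (s d) = component_of d.
Proof. by have [+ _] := componentP component_of =>
  /(_ (fun _ _ => id))[-> _]. Qed.

Lemma component_of_edge d : component_of (alpha d) = component_of d.
Proof. by have [+ _] := componentP component_of =>
  /(_ (fun _ _ => id))[_ ->]. Qed.

Lemma component_of_vertexV d : component_of ((s^-1)%g d) = component_of d.
Proof. by rewrite -component_of_vertex permKV. Qed.

Lemma component_of_face d : component_of (phi d) = component_of d.
Proof. by rewrite face_permE component_of_vertexV component_of_edge. Qed.

Lemma component_of_end e b b' : component_of (e, b) = component_of (e, b').
Proof.
case: (eqVneq b b') => [-> // | ne_b]; rewrite -component_of_edge edge_permE /=.
by case: b b' ne_b => [] [].
Qed.

Lemma mem_component_of d d' : (d \in component_of d') =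
  (component_of d == component_of d').
Proof. by apply/orbit_eqP/eqP. Qed.

Lemma in_componentE C d : C \in components M -> (d \in C) =
  (component_of d == C).
Proof. by case/imsetP=> d' _ ->; rewrite mem_component_of. Qed.

Lemma component_of_components d : component_of d \in components M.
Proof. exact: imset_f. Qed.

Lemma porbit_sub_component t d C : C \in components M ->
    (forall d, component_of (t d) = component_of d) ->
  (porbit t d \subset C) = (component_of d == C).
Proof.
move=> compC tK; rewrite -(in_componentE _ compC).
apply/subsetP/idP => [-> //|dC d' /porbitP[i ->]]; first exact: porbit_id.
rewrite !in_componentE // in dC *; rewrite -(eqP dC); apply/eqP.
by elim: i => [|i IHi]; rewrite ?expg0 ?perm1 // expgSr permM tK.
Qed.

Section Regrouping.

Variables (R : Type) (idx : R) (op : Monoid.com_law idx).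
Variable Y : {set dart M} -> R.

Lemma big_cycles t (H : {set dart M} -> R) :
    (forall d, component_of (t d) = component_of d) ->
    (forall d, H (porbit t d) = Y (component_of d)) ->
  \big[op/idx]_(O in porbits t) H O =
  \big[op/idx]_(C in components M) \big[op/idx]_(O in cycles_in t C) Y C.
Proof.
move=> tK HY; pose p (O : {set dart M}) := \bigcup_(d in O) component_of d.
have pE d : p (porbit t d) = component_of d.
  apply/eqP; rewrite eqEsubset (bigcup_sup d) ?porbit_id // andbT.
  apply/bigcupsP => d' /porbitP[i ->];
    rewrite (_ : component_of _ = component_of d) //.
  by elim: i => [|i IHi]; rewrite ?expg0 ?perm1 // expgSr permM tK.
rewrite (partition_big p (mem (components M))) => [|_ /imsetP[d _ ->]];
  last first.
  by rewrite pE; apply: component_of_components.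
apply: eq_bigr => C compC; apply: eq_big => [O|_ /andP[/imsetP[d _ ->]]].
  rewrite !inE; apply: andb_id2l => /imsetP[d _ ->].
  by rewrite pE porbit_sub_component.
by rewrite pE HY => /eqP->.
Qed.

Lemma big_edges b :
  \big[op/idx]_(e : edge M) Y (component_of (e, b)) =
  \big[op/idx]_(C in components M) \big[op/idx]_(e in edges_of C) Y C.
Proof.
rewrite (partition_big (fun e => component_of (e, b)) (mem (components M))) =>
  [|e _]; last first.
  exact: component_of_components.
apply: eq_bigr => C compC; apply: eq_big => [e|e /eqP-> //].
apply/eqP/imsetP => [eC | [[e' b'] + /= ->]].
  by exists (e, b) => //; rewrite in_componentE // eC.
by rewrite in_componentE // => /eqP<-; apply: component_of_end.
Qed.

End Regrouping.

Lemma mem_edges_of C d : C \in components M -> (d.1 \in edges_of C) = (d \in C).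
Proof.
move=> compC; apply/imsetP/idP => [[d' + eq_d]|dC]; last by exists d.
rewrite !in_componentE // => /eqP<-; case: d d' eq_d => [e b] [e' b'] /= ->.
exact/eqP/component_of_end.
Qed.

Lemma cycles_in_ext t (u : {perm dart M}) (D : {set dart M}) :
    {in D, forall d, t d \in D} -> {in D, t =1 u} ->
  cycles_in t D = cycles_in u D.
Proof.
move=> tD tu.
have iterD d i : d \in D -> (t ^+ i)%g d \in D /\ (t ^+ i)%g d = (u ^+ i)%g d.
  move=> dD; elim: i => [|i [IHD IHi]]; first by rewrite !expg0 !perm1.
  by rewrite !expgSr !permM -IHi; split; [apply: tD | apply: tu].
have porD d : d \in D -> porbit t d = porbit u d.
  move=> dD; apply/setP => d'; apply/porbitP/porbitP => -[i ->]; exists i;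
  by have [] := iterD d i dD.
apply/setP => O; rewrite !inE; apply: andb_id2r => OD.
apply/imsetP/imsetP => -[d _ defO];
  have dD: d \in D by rewrite (subsetP OD) // defO porbit_id.
  by exists d; rewrite // -porD.
by exists d; rewrite // porD.
Qed.

Lemma card_porbits_split t (D : {set dart M}) :
    (forall d, (t d \in D) = (d \in D)) ->
  #|porbits t| = (#|cycles_in t D| + #|cycles_in t (~: D)|)%N.
Proof.
move=> tD.
have powD d i : ((t ^+ i)%g d \in D) = (d \in D).
  by elim: i => [|i IHi]; rewrite ?expg0 ?perm1 // expgSr permM tD.
rewrite -(cardsID [set O : {set dart M} | O \subset D]); congr (_ + _)%N.
  by apply: eq_card => O; rewrite !inE.
apply: eq_card => O; rewrite !inE andbC; apply: andb_id2l => /imsetP[d _ ->].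
apply/idP/subsetP => [dD d' /porbitP[i ->] | dD].
  rewrite inE powD; apply: contra dD => dD; apply/subsetP => d'' /porbitP[j ->].
  by rewrite powD.
apply/subsetPn; exists d; rewrite ?porbit_id //.
by have := dD d (porbit_id _ _); rewrite inE.
Qed.

Lemma mul_tperms_edges t (es : seq (edge M)) d : uniq es ->
  mul_tperms t [seq ((e, false), (e, true)) | e <- es] d =
  if d.1 \in es then t (alpha d) else t d.
Proof.
elim: es d => //= e es IHes [e' b] /andP[e_es /IHes{}IHes]; rewrite permM IHes.
rewrite inE edge_permE /=; case: (eqVneq e' e) => [->|ne_e] /=.
  case: b; rewrite ?tpermL ?tpermR /= (negPf e_es) edge_permE //=.
by rewrite tpermD //= ?edge_permE // xpair_eqE eq_sym (negPf ne_e).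
Qed.

Lemma card_stable_component C (ps :=
  [seq ((e, false), (e, true)) | e <- enum (edges_of C)]) :
    C \in components M ->
  (#|stable_under s^-1 ps| <= 2 ^ #|cycles_in s (~: C)|.+1)%N.
Proof.
move=> compC; pose q d := if d \in C then C else porbit s d.
have sC d : (s d \in C) =
  (d \in C) by rewrite !in_componentE // component_of_vertex.
have aC d : (alpha d \in C) =
  (d \in C) by rewrite !in_componentE // component_of_edge.
rewrite /stable_under -sum1dep_card (big_factor true (q := q)); last first.
  move=> f; apply: (iffP andP) => [[/porbit_invariantP fs /allP f_ps] x y | fq].
    pose g d := if d \in C then f d else true.
    have gC : forall x y, component_of x = component_of y -> g x = g y.
      apply/componentP; split=> d; rewrite /g ?sC ?aC; case: ifP => // dC.
        by apply: fs; rewrite !porbitV -(porbit_perm _ 1 d).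
      have/(f_ps (_, _))/eqP : ((d.1, false), (d.1, true)) \in ps.
        by apply/mapP; exists d.1; rewrite // mem_enum mem_edges_of.
      by rewrite edge_permE; case: d {dC} => e [] /=.
    rewrite /q; case: ifP => xC; case: ifP => yC eq_q.
    - have := gC x y; rewrite /g xC yC; apply.
      by move: xC yC; rewrite !in_componentE // => /eqP-> /eqP->.
    - by move: yC; rewrite eq_q porbit_id.
    - by move: xC; rewrite -eq_q porbit_id.
    - by apply: fs; rewrite !porbitV.
  split.
    apply/forallP => d; apply/eqP/fq; rewrite /q -sC permKV; case: ifP => // _.
    by rewrite -[in RHS](permKV s d) -(porbit_perm _ 1 ((s^-1)%g d)) expg1.
  apply/allP => _ /mapP[e + ->] /=; rewrite mem_enum => eC.
  by apply/eqP/fq; rewrite /q -!mem_edges_of //= eC.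
rewrite sum1_card card_pffun_on card_bool leq_exp2l //.
apply: leq_trans (_ : #|C |: cycles_in s (~: C)| <= _)%N; last first.
  by rewrite cardsU1 -add1n leq_add2r leq_b1.
apply/subset_leq_card/subsetP => _ /imsetP[d _ ->]; rewrite /q.
case: ifP => dC; first exact: setU11.
rewrite !inE; apply/orP; right; rewrite imset_f //=.
apply/subsetP => d' /porbitP[i ->]; rewrite inE.
by elim: i => [|i IHi]; rewrite ?expg0 ?perm1 ?dC // expgSr permM sC.
Qed.

Lemma Euler_component C : C \in components M ->
  (#|cycles_in s C| + #|cycles_in phi C| + 2 * component_genus C)%N =
  (#|edges_of C| + 2)%N.
Proof.
move=> compC; set ps := [seq ((e, false), (e, true)) | e <- enum (edges_of C)].
have sC d : ((s^-1)%g d \in C) =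
  (d \in C) by rewrite !in_componentE // component_of_vertexV.
have aC d : (alpha d \in C) =
  (d \in C) by rewrite !in_componentE // component_of_edge.
set t := mul_tperms s^-1 ps.
have tE d : t d = if d \in C then phi d else (s^-1)%g d.
  by rewrite /t mul_tperms_edges ?enum_uniq // mem_enum mem_edges_of //
    face_permE.
have tC d : (t d \in C) = (d \in C).
  by rewrite tE; case: ifP => dC; rewrite ?face_permE sC ?aC.
have [] := @mul_tperms_cycles _ s^-1 ps.
  by apply/allP => _ /mapP[e _ ->] /=; rewrite xpair_eqE andbF.
rewrite -/t porbitsV (card_porbits_split tC).
rewrite (@card_porbits_split s C); last first.
  by move=> d; rewrite !in_componentE // component_of_vertex.
rewrite (@cycles_in_ext t phi C) => [|d dC|d dC];
  [|by rewrite tC|by rewrite tE dC].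
rewrite (@cycles_in_ext t s^-1 (~: C)) => [|d|d];
  [|by rewrite !inE tC|by rewrite inE tE => /negPf->].
have -> : cycles_in s^-1 (~: C) =
  cycles_in s (~: C) by rewrite /cycles_in porbitsV.
rewrite size_map -cardE => le2 even2.
have: (#|cycles_in phi C| + #|cycles_in s (~: C)| +
    (#|cycles_in s C| + #|cycles_in s (~: C)|) <=
  #|edges_of C| + #|cycles_in s (~: C)|.+1 * 2)%N.
  rewrite -(@leq_exp2l 2) // [leqRHS]expnD expnM; apply: leq_trans le2 _.
  by rewrite leq_mul2l leq_exp2r ?card_stable_component // orbT.
rewrite -[component_genus
  C]/((#|edges_of C| + 2 - (#|cycles_in s C| + #|cycles_in phi C|))./2).
move: even2; move: #|_| #|_| #|_| #|_| => *; lia.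
Qed.


End Components.

Section Potentials.

Variables (T : finType) (gT : finGroupType) (G : {group gT}) (s : {perm T}).
Implicit Types (x h : T -> gT).

Lemma prod_traject_potential x h n d : (forall d, h (s d) = h d * x d)%g ->
  (\prod_(c <- traject s d n) x c = (h d)^-1 * h (iter n s d))%g.
Proof.
move=> hs; elim: n d => [|n IHn] d; first by rewrite big_nil mulVg.
by rewrite trajectS big_cons IHn -iterSr iterS hs invMg !mulgA mulgV mul1g.
Qed.

Lemma orbit_prod_potential x h d : (forall d, h (s d) = h d * x d)%g ->
  (\prod_(c <- fingraph.orbit s d) x c = 1)%g.
Proof.
move=> hs; rewrite (prod_traject_potential _ _ hs) iter_order ?mulVg //.
exact: perm_inj.
Qed.

Lemma potential_exists x : (forall d, x d \in G) ->
    (forall d, \prod_(c <- fingraph.orbit s d) x c = 1)%g ->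
  exists h : {ffun T -> gT},
    (forall d, h d \in G) /\ (forall d, h (s d) = h d * x d)%g.
Proof.
move=> xG x1; pose r d := froot s d.
have sI : injective s by exact: perm_inj.
have rC d : fconnect s (r d) d by rewrite fconnect_sym // connect_root.
have rs d : r (s d) = r d.
  apply/(fingraph.rootP (fconnect_sym sI)); rewrite fconnect_sym //;
    exact: fconnect1.
exists [ffun d => \prod_(c <- traject s (r d) (findex s (r d) d)) x c]%g.
split=> d; rewrite !ffunE; first by apply: group_prod.
rewrite rs; set n := findex s (r d) d.
have ltn : (n < fingraph.order s (r d))%N by apply: findex_max.
have dE : d = iter n s (r d) by rewrite iter_findex.
rewrite [in x d]dE -big_rcons -trajectSr.
have sdE : s d = iter n.+1 s (r d) by rewrite iterS -dE.
move: ltn; rewrite leq_eqVlt => /predU1P[n_last | lt_n]; last first.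
  by rewrite sdE findex_iter.
have -> : s d = r d by rewrite sdE n_last iter_order.
by rewrite findex0 big_nil n_last x1.
Qed.

Lemma card_potentials x : (forall d, x d \in G) ->
    (forall d, \prod_(c <- fingraph.orbit s d) x c = 1)%g ->
  #|[set h : {ffun T -> gT} |
      [forall d, h d \in G] && [forall d, h (s d) == h d * x d]%g]| =
  (#|G| ^ #|porbits s|)%N.
Proof.
move=> xG x1; have [h0 [h0G h0s]] := potential_exists xG x1.
pose mulh0 (k : {ffun T -> gT}) : {ffun T -> gT} := [ffun d => k d * h0 d]%g.
pose divh0 (k : {ffun T -> gT}) : {ffun T -> gT} := [ffun d =>
  k d * (h0 d)^-1]%g.
have mulK : cancel mulh0 divh0 by move=> k; apply/ffunP => d;
  rewrite !ffunE mulgK.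
have divK : cancel divh0 mulh0 by move=> k; apply/ffunP => d;
  rewrite !ffunE mulgKV.
rewrite -(card_imset _ (can_inj divK)).
transitivity #|[set k : {ffun T ->
  gT} | [forall d, k (s d) == k d] && [forall d, k d \in G]]|.
  apply: eq_card => k; rewrite inE; apply/imsetP/andP.
    case=> h; rewrite inE => /andP[/forallP hG /forallP hs] ->; split;
      apply/forallP => d.
      by rewrite !ffunE (eqP (hs d)) h0s invMg mulgA mulgK.
    by rewrite ffunE groupM ?groupV.
  case=> /forallP ks /forallP kG; exists (mulh0 k); rewrite ?mulK // inE.
  apply/andP; split; apply/forallP => d; rewrite !ffunE;
    first by rewrite groupM.
  by rewrite (eqP (ks d)) h0s mulgA.
rewrite -sum1dep_card big_mkcondr /=
  (big_factor 1%g _ _ (@porbit_invariantP _ s _)).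
rewrite -big_mkcondr sum1dep_card -(card_pffun_on 1%g); apply: eq_card => k.
rewrite inE; apply/andP/pffun_onP =>
  [[/pffun_onP[k_supp _] /forallP kG] | [k_supp kG]].
  by split=> // _ /imageP[_ /imsetP[d _ ->] ->]; have := kG d; rewrite ffunE.
split; first by apply/pffun_onP.
by apply/forallP => d; rewrite ffunE; apply/kG/image_f/imset_f.
Qed.

End Potentials.

Section CountingFlows.

Variables (M : surface_map) (gT : finGroupType) (G : {group gT}).
Notation s := (vertex_perm M).
Notation alpha := (edge_perm M).
Notation phi := (face_perm M).

Definition flows (o : edge M -> bool) : {set {ffun edge M -> gT}} :=
  [set a : {ffun edge M -> gT} | [forall e, a e \in G] && local_flow o a].

(* The [h] for which the values [a e := (h d)^-1 * h (s d)], read off along one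
   dart of each edge, are consistent with those along the other dart. *)
Definition edge_potentials : {set {ffun dart M -> gT}} :=
  [set h : {ffun dart M -> gT} | [forall d, h d \in G] &&
    [forall e, let d := (e, false) in let d' := (e, true) in
       (h d)^-1 * h (s d) * (h d')^-1 * h (s d') == 1]%g].

Lemma dart_value_in o (a : {ffun edge M -> gT}) d :
  (forall e, a e \in G) -> dart_value o a d \in G.
Proof. by move=> aG; rewrite /dart_value; case: ifP; rewrite ?groupV. Qed.

Lemma dart_value_edge (o : edge M -> bool) (a : {ffun edge M -> gT}) d :
  (dart_value o a (alpha d) = (dart_value o a d)^-1)%g.
Proof.
rewrite /dart_value edge_permE; case: d => e b /=.
by case: b (o e) => [] []; rewrite /= ?invgK.
Qed.

Lemma edge_potentialP (h : {ffun dart M -> gT}) :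
  reflect ((forall d, h d \in G) /\
      forall d, (h (alpha d))^-1 * h (s (alpha d)) = ((h d)^-1 * h (s d))^-1)%g
    (h \in edge_potentials).
Proof.
rewrite inE; apply: (iffP andP) => -[].
  move=> /forallP hG /forallP /= hE; split=> // -[e b]; rewrite edge_permE /=.
  have /eqP := hE e; rewrite -mulgA => hE1.
  have := hE1; rewrite -[X in (X * _)%g]invgK => /(canRL (mulKVg _)).
  by rewrite mulg1 => hE2; case: b => //=; rewrite hE2 invgK.
move=> hG hE; split; apply/forallP => //= e; rewrite -mulgA.
by have := hE (e, false); rewrite edge_permE /= => ->; rewrite mulgV.
Qed.

Lemma card_flows (o : edge M -> bool) :
  #|edge_potentials| = (#|flows o| * #|G| ^ #|porbits s|)%N.
Proof.
pose val_of (h : {ffun dart M -> gT}) : {ffun edge M -> gT} :=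
  [ffun e => (h (e, o e))^-1 * h (s (e, o e))]%g.
have valE h d : h \in edge_potentials ->
    (h (s d) = h d * dart_value o (val_of h) d)%g.
  case/edge_potentialP=> hG hE; rewrite /dart_value ffunE; case: d => e b /=.
  case: eqP => [->|/eqP ne_b]; first by rewrite mulKVg.
  have -> : (e, o e) = alpha (e, b).
    by rewrite edge_permE /=; case: b (o e) ne_b => [] [].
  by rewrite hE invgK mulKVg.
rewrite -sum1_card (partition_big val_of (mem (flows o))) /=; last first.
  move=> h h_pot; have /edge_potentialP[hG _] := h_pot.
  rewrite inE; apply/andP; split; [apply/forallP => e | apply/forallP => d].
    by rewrite ffunE groupM ?groupV.
  by apply/eqP/(@orbit_prod_potential _ _ _ _ h) => d'; apply: valE.
rewrite -sum_nat_const; apply: eq_bigr => a.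
rewrite inE => /andP[/forallP aG /forallP a1].
rewrite -(@card_potentials _ _ _ _ (dart_value o a)) => [|d|d]; last 2 first.
- exact: dart_value_in.
- exact/eqP/a1.
rewrite sum1dep_card; apply: eq_card => h; rewrite [LHS]inE [RHS]inE.
apply/andP/andP => [[h_pot /eqP <-] | [/forallP hG /forallP hs]].
  have /edge_potentialP[hG _] := h_pot.
  by split; apply/forallP => // d; rewrite valE.
have dv d : (dart_value o a d =
  (h d)^-1 * h (s d))%g by rewrite (eqP (hs d)) mulKg.
split.
  by apply/edge_potentialP; split=> // d; rewrite -!dv dart_value_edge.
by apply/eqP/ffunP => e; rewrite ffunE -dv /dart_value /= eqxx.
Qed.

Notation I := (irr_index G).
Notation entry := (@irr_entry gT G).
Notation dimI P := ((irr_dim (tag P))%:R : algC).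

Lemma irr_entry_delta4 a b c d : a \in G -> b \in G -> c \in G -> d \in G ->
  (a * b * c * d == 1)%g%:R = #|G|%:R^-1 *
    \sum_(p : (I * I) * (I * I)) dimI p.2.1 *
      ((entry a p.2.1 p.1.2 * entry b p.1.2 p.1.1) *
       (entry c p.1.1 p.2.2 * entry d p.2.2 p.2.1)) :> algC.
Proof.
move=> Ga Gb Gc Gd; rewrite (@irr_entry_delta _ G) ?groupM //; congr (_ * _).
transitivity (\sum_(P : I) \sum_(Q : I) \sum_(S : I) \sum_(U : I) dimI P *
  ((entry a P Q * entry b Q S) * (entry c S U * entry d U P))).
  apply: eq_bigr => P _; rewrite -irr_entryM ?groupM // mulr_sumr.
  rewrite (eq_bigr (fun U => \sum_(S : I) \sum_(Q : I) dimI P *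
     ((entry a P Q * entry b Q S) * (entry c S U * entry d U P)))); last first.
    move=> U _; rewrite -irr_entryM ?groupM // mulr_suml mulr_sumr.
    apply: eq_bigr => S _; rewrite -irr_entryM // !mulr_suml mulr_sumr.
    by apply: eq_bigr => Q _; rewrite -!mulrA.
  rewrite exchange_big [RHS]exchange_big; apply: eq_bigr => S _ /=.
  by rewrite [RHS]exchange_big.
rewrite -(pair_bigA _ (fun (x y : I * I) => dimI y.1 *
   ((entry a y.1 x.2 * entry b x.2 x.1) * (entry c x.1 y.2 * entry d y.2 y.1))))
     /=.
rewrite -(pair_bigA _ (fun (S Q : I) => \sum_(y : I * I) dimI y.1 *
   ((entry a y.1 Q * entry b Q S) * (entry c S y.2 * entry d y.2 y.1)))) /=.
rewrite [LHS]exchange_big [RHS]exchange_big; apply: eq_bigr => Q _ /=.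
rewrite [LHS]exchange_big; apply: eq_bigr => S _ /=.
by rewrite -(pair_bigA _ (fun (P U : I) => dimI P *
   ((entry a P Q * entry b Q S) * (entry c S U * entry d U P)))).
Qed.

End CountingFlows.

Section FourierTransform.

Variables (M : surface_map) (gT : finGroupType) (G : {group gT}).
Notation s := (vertex_perm M).
Notation alpha := (edge_perm M).
Notation phi := (face_perm M).
Notation I := (irr_index G).
Notation entry := (@irr_entry gT G).
Notation dimI P := ((irr_dim (tag P))%:R : algC).
Notation index_fun := {ffun dart M -> I}.
Notation index_pair := (index_fun * index_fun)%type.
Implicit Types (p : index_pair) (l : {ffun dart M -> Iirr G}).

Lemma prod_darts (F : dart M -> algC) :
  \prod_d F d = \prod_e (F (e, false) * F (e, true)).
Proof.
rewrite (eq_bigr (fun d => F (d.1, d.2))); last by case.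
rewrite -(pair_bigA _ (fun e b => F (e, b))); apply: eq_bigr => e _ /=.
by rewrite big_bool mulrC.
Qed.

Lemma prod_bool (J : finType) (B : pred J) :
  \prod_j (B j)%:R = [forall j, B j]%:R :> algC.
Proof.
have [/forallP allB|/forallPn[j notB]] := boolP [forall j, B j].
  by rewrite big1 // => j _; rewrite allB.
by rewrite (bigD1 j) //= (negPf notB) mul0r.
Qed.

Lemma card_edge_potentials_Fourier :
  #|edge_potentials M G|%:R = #|G|%:R ^- n_edges M *
    \sum_(p : index_pair) (\prod_e dimI (p.1 (e, true))) *
      \prod_d \sum_(a in G)
        entry a^-1%g (p.1 (alpha d)) (p.2 d) *
        entry a (p.2 ((s^-1)%g d)) (p.1 ((s^-1)%g d)).
Proof.
pose A (p : index_pair) (h : {ffun dart M -> gT}) d :=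
  entry (h d)^-1%g (p.1 (alpha d)) (p.2 d).
pose B (p : index_pair) (h : {ffun dart M -> gT}) d :=
  entry (h (s d)) (p.2 d) (p.1 d).
transitivity (\sum_(h in ffun_on (mem G)) #|G|%:R ^- n_edges M *
  \sum_(p : index_pair) (\prod_e dimI (p.1 (e,
    true))) * \prod_d (A p h d * B p h d)).
  rewrite -sum1dep_card natr_sum big_mkcondr /=.
  apply: eq_big => [h | h /forallP hG]; first by apply/forallP/ffun_onP.
  rewrite -mulrb -prod_bool.
  pose F e (q : (I * I) * (I * I)) := dimI q.2.1 *
      ((entry (h (e, false))^-1%g q.2.1 q.1.2 * entry (h (s (e,
        false))) q.1.2 q.1.1) *
       (entry (h (e, true))^-1%g q.1.1 q.2.2 * entry (h (s (e,
         true))) q.2.2 q.2.1)).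
  rewrite (eq_bigr (fun e => #|G|%:R^-1 * \sum_q F e q)); last first.
    by move=> e _; apply: irr_entry_delta4; rewrite ?groupV.
  rewrite big_split prodr_const /= -exprVn; congr (_ * _).
  rewrite bigA_distr_bigA.
  pose up (p : index_pair) := [ffun e =>
    ((p.1 (e, false), p.2 (e, false)), (p.1 (e, true), p.2 (e, true)))].
  pose down (u : {ffun edge M -> (I * I) * (I * I)}) : index_pair :=
    ([ffun d => if d.2 then (u d.1).2.1 else (u d.1).1.1],
     [ffun d => if d.2 then (u d.1).2.2 else (u d.1).1.2]).
  rewrite (reindex up); last first.
    exists down => [[t w] _ | u _].
      by congr (_, _); apply/ffunP => -[e []]; rewrite !ffunE.
    by apply/ffunP => e; rewrite !ffunE /=; case: (u e) => [[? ?] [? ?]].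
  apply: eq_bigr => p _; rewrite prod_darts -big_split; apply: eq_bigr => e _.
  by rewrite /A /B /F !ffunE !edge_permE.
rewrite -mulr_sumr; congr (_ * _); rewrite exchange_big;
  apply: eq_bigr => p _ /=.
rewrite -mulr_sumr; congr (_ * _); rewrite bigA_distr_big;
  apply: eq_bigr => h _ /=.
rewrite big_split [in RHS]big_split; congr (_ * _) => /=.
rewrite (reindex_inj (@perm_inj _ (s^-1)%g)); apply: eq_bigr => d _.
by rewrite /B permKV.
Qed.

Definition index_condition p := [forall d,
  [&& p.1 (phi d) == p.1 d,
    p.2 (s d) == p.2 d & tag (p.1 (alpha d)) == tag (p.2 d)]].

Lemma card_edge_potentials_index :
  #|edge_potentials M G|%:R = #|G|%:R ^+ n_edges M *
    \sum_(p : index_pair | index_condition p) \prod_e (dimI (p.1 (e,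
      false)))^-1.
Proof.
rewrite card_edge_potentials_Fourier [in RHS]big_mkcond /= !mulr_sumr.
apply: eq_bigr => p _; under [X in _ * (_ * X)]eq_bigr =>
  d _ do rewrite irr_entry_Schur.
rewrite big_split /= (prod_bool (fun d => [&& _, _ & _])).
have -> : [forall d, [&& p.1 (alpha d) == p.1 (s^-1%g d),
  p.2 d == p.2 (s^-1%g d) &
    tag (p.1 (alpha d)) == tag (p.2 d)]] = index_condition p.
  apply/forallP/forallP => cond d.
    have /and3P[c1 _ _] := cond (alpha d); have /and3P[_ _ c3] := cond d.
    have /and3P[_ c2 _] := cond (s d).
    rewrite c3 -{2}(edge_permK d) (eqP c1) face_permE eqxx.
    by rewrite (eqP c2) permK eqxx.
  have /and3P[c1 _ _] := cond (alpha d); have /and3P[_ _ c3] := cond d.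
  have /and3P[_ c2 _] := cond (s^-1%g d).
  by rewrite c3 -(eqP c1) face_permE edge_permK eqxx -(eqP c2) permKV eqxx.
case: ifP => _; rewrite ?mulr0 // mulr1 (prod_darts (fun d =>
  _ / _)) -big_split /=.
have prodG (x : algC) : x ^+ n_edges M =
  \prod_(e : edge M) x by rewrite prodr_const.
rewrite -exprVn !prodG -!big_split; apply: eq_bigr => e _ /=.
rewrite !edge_permE /=.
have nG : #|G|%:R != 0 :> algC by exact: neq0CG.
have n1 := irr_dim_neq0 (tag (p.1 (e, true))).
have n0 := irr_dim_neq0 (tag (p.1 (e, false))).
by field; rewrite n1 n0 nG.
Qed.

Definition lifts_count (t : {perm dart M}) l : algC :=
  \sum_(f : index_fun | [forall d, (f (t d) == f d) && (tag (f d) == l d)]) 1.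

Lemma index_sum_labels :
  \sum_(p : index_pair | index_condition p) \prod_e (dimI (p.1 (e, false)))^-1 =
  \sum_(l : {ffun dart M ->
    Iirr G} | [forall d, (l (s d) == l d) && (l (alpha d) == l d)])
    (\prod_e (irr_dim (l (e, false)))%:R^-1) *
      (lifts_count phi l * lifts_count s l).
Proof.
rewrite (partition_big (fun p : index_pair => [ffun d => tag (p.1 d)])
  (fun l : {ffun dart M -> Iirr G} =>
    [forall d, (l (s d) == l d) && (l (alpha d) == l d)])) /=; last first.
  move=> p /forallP cond.
  have phiP d : p.1 (phi d) = p.1 d by have /and3P[/eqP] := cond d.
  have sP d : p.2 (s d) = p.2 d by have /and3P[_ /eqP] := cond d.
  have aP d : tag (p.1 (alpha d)) = tag (p.2 d) by have /and3P[_ _ /eqP] :=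
    cond d.
  have aP2 d : tag (p.2 (alpha d)) = tag (p.1 d) by rewrite -aP edge_permK.
  have key y : tag (p.2 (alpha y)) = tag (p.2 y).
    have yE : phi (alpha (s y)) = y by rewrite face_permE edge_permK permK.
    by rewrite aP2 -{1}yE phiP aP sP.
  have tE d : tag (p.1 d) = tag (p.2 d) by rewrite -aP2 key.
  by apply/forallP => d; rewrite !ffunE !tE sP key !eqxx.
apply: eq_bigr => l /forallP lP.
have ls d : l (s d) = l d by have /andP[/eqP] := lP d.
have la d : l (alpha d) = l d by have /andP[_ /eqP] := lP d.
rewrite (eq_bigr (fun=> (\prod_e (irr_dim (l (e, false)))%:R^-1) * 1));
  last first.
  move=> p /andP[_ /eqP <-]; rewrite mulr1.
  by apply: eq_bigr => e _; rewrite ffunE.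
rewrite -mulr_sumr; congr (_ * _);
  rewrite /lifts_count big_distrlr /= pair_big /=.
apply: eq_big => [p|p _]; last by rewrite mulr1.
apply/andP/andP => [[/forallP cond /eqP lE] | [/forallP c1 /forallP c2]].
  have tE d : tag (p.1 d) = l d by rewrite -lE ffunE.
  split; apply/forallP => d; have /and3P[c1 c2 /eqP c3] := cond d.
    by rewrite c1 tE eqxx.
  by rewrite c2 -c3 tE la eqxx.
split.
  apply/forallP => d; have /andP[-> _] := c1 d; have /andP[-> /eqP->] := c2 d.
  by have /andP[_ /eqP->] := c1 (alpha d); rewrite la eqxx.
by apply/eqP/ffunP => d; rewrite ffunE; have /andP[_ /eqP->] := c1 d.
Qed.

Let irr_index0 : irr_index G := Tagged _ (Ordinal (irr_dim_gt0 (0 : Iirr G))).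

Lemma lifts_count_component (t : {perm dart M}) (g : {ffun {set dart M} ->
  Iirr G}) :
    (forall d, component_of (t d) = component_of d) ->
  lifts_count t [ffun d => g (component_of d)] =
  \prod_(C in components M) (irr_dim (g C))%:R ^+ #|cycles_in t C|.
Proof.
move=> tK.
pose H (O : {set dart M}) (P : I) : algC :=
  [forall d, (d \in O) ==> (tag P == g (component_of d))]%:R.
transitivity (\sum_(f : index_fun | [forall d, f (t d) == f d])
    [forall d, tag (f d) == g (component_of d)]%:R : algC).
  rewrite /lifts_count big_mkcond [RHS]big_mkcond; apply: eq_bigr => f _ /=.
  have -> : [forall d, (f (t d) == f d) && (tag (f d) == [ffun d =>
    g (component_of d)] d)] =
      [forall d, f (t d) == f d] && [forall d, tag (f d) == g (component_of d)].
    apply/forallP/andP => [fP | [/forallP f1 /forallP f2] d].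
      by split; apply/forallP => d; have := fP d; rewrite ffunE => /andP[].
    by rewrite f1 ffunE f2.
  by do 2!case: [forall _, _].
rewrite (sum_factor irr_index0 (H := H) (@porbit_invariantP _ t _)); last first.
  move=> f; rewrite big_mkcond /= (eq_bigr (fun O : {set dart M} =>
    ((O \in porbits t) ==> [forall d,
      (d \in O) ==> (tag (f O) == g (component_of d))])%:R)).
    rewrite (prod_bool (fun O : {set dart M} => _ ==> _)); congr (_%:R);
      congr (nat_of_bool _).
    apply/forallP/forallP => [fP O | fP d].
      apply/implyP => /imsetP[d _ ->]; apply/forallP => d'; apply/implyP.
      by rewrite -eq_porbit_mem => /eqP<-; have := fP d'; rewrite ffunE.
    rewrite ffunE; have := fP (porbit t d);
      rewrite imset_f //= => /forallP/(_ d).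
    by rewrite porbit_id.
  by move=> O _; rewrite /H; case: (O \in _).
rewrite (@big_cycles M _ _ _ (fun C => (irr_dim (g C))%:R) _ _ tK).
  by apply: eq_bigr => C _; rewrite prodr_const.
move=> d; rewrite sum_irr_index (bigD1 (g (component_of d))) //=
  [X in _ + X]big1 ?addr0.
  rewrite (eq_bigr (fun=> 1)) ?sumr_const ?card_ord // => k _.
  rewrite /H; case: forallP => // -[] d'; apply/implyP => /= dd'.
  have: porbit t d' \subset component_of d' by rewrite porbit_sub_component
    ?component_of_components.
  move/subsetP/(_ d); rewrite -eq_porbit_mem eq_sym eq_porbit_mem
    mem_component_of.
  by move=> /(_ dd')/eqP->.
move=> i ne_i; apply: big1 => k _; rewrite /H; case: forallP => // /(_ d).
by rewrite porbit_id /= (negPf ne_i).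
Qed.

Lemma card_edge_potentials_components :
  #|edge_potentials M G|%:R = #|G|%:R ^+ n_edges M *
    \prod_(C in components M) \sum_(i : Iirr G)
      (irr_dim i)%:R ^+ #|cycles_in s C| * (irr_dim i)%:R ^+ #|cycles_in phi C|
        /
      (irr_dim i)%:R ^+ #|edges_of C| :> algC.
Proof.
rewrite card_edge_potentials_index index_sum_labels; congr (_ * _).
pose H (C : {set dart M}) (i : Iirr G) : algC :=
  (irr_dim i)%:R ^+ #|cycles_in s C| * (irr_dim i)%:R ^+ #|cycles_in phi C| /
      (irr_dim i)%:R ^+ #|edges_of C|.
apply: (@sum_factor _ _ _ (@component_of M) 0 _ _ _ H) => [l|g].
  apply: (iffP forallP) => [lP | lP d].
    by apply/componentP; split=> d; have /andP[/eqP ? /eqP ?] := lP d.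
  by have [ls la] := (componentP l).1 lP; rewrite ls la !eqxx.
rewrite !lifts_count_component;
  [|exact: component_of_vertex|exact: component_of_face].
rewrite (eq_bigr (fun e => (irr_dim (g (component_of (e, false))))%:R^-1));
  last first.
  by move=> e _; rewrite ffunE.
rewrite (big_edges _ (fun C => (irr_dim (g C))%:R^-1)) -!big_split;
  apply: eq_bigr => C _ /=.
by rewrite prodr_const exprVn /H mulrC [X in X / _]mulrC.
Qed.

End FourierTransform.

Section Deletion.

Variables (M : surface_map) (B : {set edge M}).
Notation s := (vertex_perm M).
Notation N := (delete B).
Notation toM := (@to_dart M B).
Notation ofM := (@of_dart M B).

Lemma of_dart_kept (d : dart M) : d.1 \notin B -> exists2 u, ofM d =
  Some u & toM u = d.
Proof.
case: d => e b /= e_kept; exists (Sub e e_kept, b);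
  last by rewrite /to_dart SubK.
by rewrite /of_dart /= insubT.
Qed.

Lemma of_dart_deleted (d : dart M) : d.1 \in B -> ofM d = None.
Proof. by move=> dB; rewrite /of_dart insubN // negbK. Qed.

Lemma of_dart_NoneP (d : dart M) : ofM d = None -> d.1 \in B.
Proof. by move=> dN; apply: contraT => /of_dart_kept[u]; rewrite dN. Qed.

Lemma to_dart_kept (u : dart N) : (toM u).1 \notin B.
Proof. exact: (valP u.1). Qed.

Lemma to_dart_inj : injective toM.
Proof. exact: pcan_inj (@to_dartK M B). Qed.

Lemma delete_next (u : dart N) : exists2 i,
  toM (vertex_perm N u) = iter i.+1 s (toM u) &
  forall j, (j < i)%N -> (iter j.+1 s (toM u)).1 \in B.
Proof.
have [i Ei Hi] := kept_perm_funP u; exists i; first by rewrite permE.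
by move=> j /Hi/of_dart_NoneP.
Qed.

Lemma orbit_cons (T : finType) (f : T -> T) x :
  fingraph.orbit f x = x :: traject f (f x) (fingraph.order f x).-1.
Proof. by rewrite /fingraph.orbit -orderSpred. Qed.

Lemma orbit_next (t : {perm dart M}) d : fingraph.orbit t (t d) =
  rcons (traject t (t d) (fingraph.order t d).-1) d.
Proof.
have tI : injective t by exact: perm_inj.
have -> : fingraph.orbit t (t d) = traject t (t d) (fingraph.order t d).
  congr traject; apply: eq_card => d'.
  by rewrite !inE [RHS](same_fconnect1 tI).
by rewrite -orderSpred trajectSr -iterSr orderSpred iter_order.
Qed.

Lemma porbit_delete (u : dart N) :
  porbit (vertex_perm N) u = toM @^-1: porbit s (toM u).
Proof.
apply/setP => u'; rewrite inE; apply/porbitP/porbitP => [[n ->]|[n]].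
  elim: n => [|n [m IHn]]; first by exists 0%N; rewrite !expg0 !perm1.
  have [i Ei _] := delete_next ((vertex_perm N ^+ n)%g u).
  by exists (m + i.+1)%N; rewrite expgSr permM Ei IHn -permX -permM -expgD.
rewrite permX; elim/ltn_ind: n u => n IHn u.
case: n IHn => [_ /= /to_dart_inj->|n IHn]; first by exists 0%N;
  rewrite expg0 perm1.
have [i Ei Hi] := delete_next u.
have [lt_ni | le_in] := ltnP n i.
  by move=> u'E; have := Hi _ lt_ni; rewrite -u'E (negPf (to_dart_kept _)).
rewrite -(subnK le_in) -addnS iterD -Ei => /IHn[|m ->];
  first by rewrite ltnS leq_subr.
by exists m.+1; rewrite expgS permM.
Qed.

Lemma n_vertices_delete : n_vertices N = n_vertices M.
Proof.
rewrite /n_vertices /= -(cardsID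
  [set O : {set dart M} | O \subset [set d | d.1 \in B]] (porbits s)).
have -> : (porbits s :&: [set O : {set dart M} | O \subset [set d | d.1 \in B]])
  =
    [set O in porbits s | O \subset [set d | d.1 \in B]] by apply/setP => O;
      rewrite !inE.
set D := _ :\: _; suff -> : #|porbits (vertex_perm N)| =
  #|D| by rewrite addnCA addnC -addnA addnCA addnA.
have DP O : O \in D -> exists u, O = porbit s (toM u).
  rewrite !inE => /andP[/subsetPn[d dO] + /imsetP[d0 _ defO]];
    rewrite inE => d_kept.
  have [u _ uE] := of_dart_kept d_kept; exists u; apply/eqP.
  by rewrite uE defO eq_sym eq_porbit_mem -defO.
have -> : porbits (vertex_perm N) = (fun O : {set dart M} => toM @^-1: O) @: D.
  apply/setP => O'; apply/imsetP/imsetP => [[u _ ->] | [O /DP[u ->] ->]].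
    exists (porbit s (toM u)); last exact: porbit_delete.
    rewrite !inE imset_f // andbT; apply/subsetPn; exists (toM u);
      rewrite ?porbit_id //.
    by rewrite inE to_dart_kept.
  by exists u => //; rewrite porbit_delete.
rewrite card_in_imset // => O O' /DP[u ->] /DP[u' ->] eqO; apply/eqP.
by rewrite eq_porbit_mem; have := porbit_id (vertex_perm N) u;
  rewrite porbit_delete eqO inE.
Qed.

Lemma n_edges_delete : n_edges N = #|~: B|.
Proof. by rewrite /n_edges card_sig; apply: eq_card => e; rewrite !inE. Qed.

Section Flows.

Variables (gT : finGroupType) (G : {group gT}) (o : edge M -> bool).

Definition extend_by_1 (a : {ffun edge N -> gT}) : {ffun edge M -> gT} :=
  [ffun e => if insub e is Some u then a u else 1%g].

Definition kept_orientation (u : edge N) : bool := o (val u).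

Lemma extend_by_1_val a u : extend_by_1 a (val u) = a u.
Proof. by rewrite ffunE valK. Qed.

Lemma extend_by_1_deleted a e : e \in B -> extend_by_1 a e = 1%g.
Proof. by move=> eB; rewrite ffunE insubN // negbK. Qed.

Lemma dart_value_kept a (u : dart N) :
  dart_value o (extend_by_1 a) (toM u) = dart_value kept_orientation a u.
Proof. by rewrite /dart_value extend_by_1_val. Qed.

Lemma dart_value_deleted a (d : dart M) :
  d.1 \in B -> dart_value o (extend_by_1 a) d = 1%g.
Proof. by move=> dB; rewrite /dart_value extend_by_1_deleted //
  invg1 if_same. Qed.

Lemma local_flow_extend (a : {ffun edge N -> gT}) : (forall u, a u \in G) ->
  local_flow o (extend_by_1 a) = local_flow kept_orientation a.
Proof.
move=> aG; have xG d : dart_value o (extend_by_1 a) d \in G.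
  have [dB | /of_dart_kept[u _ <-]] := boolP (d.1 \in B).
    by rewrite dart_value_deleted.
  by rewrite dart_value_kept /dart_value; case: ifP; rewrite ?groupV.
have x'G u : dart_value kept_orientation a u \in G by rewrite -dart_value_kept.
apply/forallP/forallP => [flow u | flow d].
  have [h [_ hs]] := potential_exists xG (fun d => eqP (flow d)).
  apply/eqP/(@orbit_prod_potential _ _ _ _ (fun u => h (toM u))) => {}u.
  have [i -> Hi] := delete_next u; rewrite -dart_value_kept.
  elim: i Hi => [_|i IHi Hi]; first exact: hs.
  rewrite iterS hs dart_value_deleted ?Hi // mulg1; apply: IHi => j lt_ji.
  exact/Hi/ltnW.
have [h [_ hs]] := potential_exists x'G (fun d => eqP (flow d)).
pose first d := ohead (pmap ofM (fingraph.orbit s d)).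
pose k d := if first d is Some u then h u else 1%g.
apply/eqP/(@orbit_prod_potential _ _ _ _ k) => {}d; rewrite /k /first.
have [dB | /of_dart_kept[u uE <-]] := boolP (d.1 \in B).
  rewrite dart_value_deleted // mulg1 orbit_next orbit_cons -cats1 pmap_cat /=.
  by rewrite of_dart_deleted // cats0.
rewrite dart_value_kept [in RHS]orbit_cons /= to_dartK /= -hs permE.
rewrite /= /kept_perm_fun; case E: (pmap _ _) => //.
have : u \in pmap ofM (fingraph.orbit s (s (toM u))).
  by rewrite mem_pmap orbit_next map_rcons mem_rcons to_dartK mem_head.
by rewrite E.
Qed.

Lemma card_flows_delete : #|flows G kept_orientation| =
  #|[set a in flows G o | [forall e in B, a e == 1%g]]|.
Proof.
have extI : injective extend_by_1.
  by move=> a a' eq_a; apply/ffunP => u; rewrite -!extend_by_1_val eq_a.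
rewrite -(card_imset _ extI); apply: eq_card => a; rewrite !inE.
apply/imsetP/andP => [[a' + ->] | [/andP[/forallP aG a_flow] /forall_inP a1]].
  rewrite inE => /andP[/forallP aG flow];
    rewrite local_flow_extend // flow andbT.
  split; last by apply/forall_inP => e eB; rewrite extend_by_1_deleted.
  apply/forallP => e; have [eB | e_kept] := boolP (e \in B).
    by rewrite extend_by_1_deleted.
  by rewrite -(SubK (edge N) e_kept) extend_by_1_val.
have a_ext : a = extend_by_1 [ffun u => a (val u)].
  apply/ffunP => e; have [eB | e_kept] := boolP (e \in B).
    by rewrite extend_by_1_deleted // (eqP (a1 e eB)).
  by rewrite -[in RHS](SubK (edge N) e_kept) extend_by_1_val ffunE SubK.
exists [ffun u => a (val u)] => //; rewrite inE.
have a'G u : [ffun u : edge N => a (val u)] u \in G by rewrite ffunE.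
rewrite -local_flow_extend // -a_ext a_flow andbT.
by apply/forallP.
Qed.

End Flows.

End Deletion.

Section Duality.

Variable M : surface_map.
Notation s := (vertex_perm M).
Notation alpha := (edge_perm M).
Notation phi := (face_perm M).

(* Not a conversion: [edge_perm] is built from the opaque [opp_dartK]. *)
Lemma edge_perm_dual : edge_perm (dual M) = alpha.
Proof. by apply/permP => d; rewrite [LHS]permE [RHS]permE. Qed.

Lemma face_perm_dual : face_perm (dual M) = (s ^ alpha)%g.
Proof.
have aV : (alpha^-1 = alpha)%g.
  by apply/permP => d; apply: (canLR (permK _)); rewrite edge_permK.
rewrite {1}/face_perm edge_perm_dual.
change (alpha * (alpha * s^-1)^-1 = s ^ alpha)%g.
by rewrite invMg invgK conjgE aV.
Qed.

Lemma porbit_conj (t : {perm dart M}) d :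
  porbit (t ^ alpha)%g (alpha d) = alpha @: porbit t d.
Proof.
apply/setP => d'; apply/porbitP/imsetP => [[i ->] | [_ /porbitP[i ->] ->]].
  by exists ((t ^+ i)%g d); rewrite ?mem_porbit // -conjXg permJ.
by exists i; rewrite -conjXg permJ.
Qed.

Lemma cycles_in_conj (t : {perm dart M}) (C : {set dart M}) :
    (forall d, (alpha d \in C) = (d \in C)) ->
  #|cycles_in (t ^ alpha)%g C| = #|cycles_in t C|.
Proof.
move=> aC; have imI : injective (fun O : {set dart M} => alpha @: O).
  by apply: imset_inj; apply: perm_inj.
rewrite -(card_imset (mem (cycles_in t C)) imI); apply: eq_card => O;
  rewrite inE.
have subC (O' : {set dart M}) : (alpha @: O' \subset C) = (O' \subset C).
  apply/subsetP/subsetP => sub d dO; first by rewrite -aC sub // imset_f.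
  by case/imsetP: dO => d' d'O ->; rewrite aC sub.
apply/andP/imsetP => [[/imsetP[d _ ->]] | [O']].
  rewrite -(edge_permK d) porbit_conj subC => OC.
  by exists (porbit t (alpha d)); rewrite // inE OC imset_f.
rewrite inE => /andP[/imsetP[d _ ->] OC] ->; rewrite subC; split=> //.
by rewrite -porbit_conj imset_f.
Qed.

Lemma components_dual : components (dual M) = components M.
Proof.
rewrite /components /=; congr imset;
  suff -> : <<[set face_perm M; edge_perm (dual M)]>>%g =
    <<[set vertex_perm M; edge_perm M]>>%g by [].
rewrite edge_perm_dual; apply/eqP;
  rewrite eqEsubset !gen_subG !subUset !sub1set.
have mem1 (a b : {perm dart M}) : a \in <<[set a;
  b]>>%g by rewrite mem_gen // set21.
have mem2 (a b : {perm dart M}) : b \in <<[set a;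
  b]>>%g by rewrite mem_gen // set22.
have sE : s = (phi^-1 * alpha)%g by rewrite /face_perm invMg invgK mulgKV.
rewrite !mem2 !andbT; apply/andP; split.
  by apply: groupM; rewrite ?groupV; [apply: mem2 | apply: mem1].
by rewrite [X in X \in _]sE; apply: groupM; rewrite ?groupV;
  [apply: mem1 | apply: mem2].
Qed.

Lemma in_component_edge C d : C \in components M -> (alpha d \in C) = (d \in C).
Proof. by move=> compC; rewrite !in_componentE // component_of_edge. Qed.

Lemma n_faces_dual : n_faces (dual M) = n_vertices M.
Proof.
have card_all t : #|porbits t| = #|@cycles_in M t setT|.
  by apply: eq_card => O; rewrite inE subsetT andbT.
rewrite /n_faces /n_vertices face_perm_dual !card_all cycles_in_conj // => d.
by rewrite !inE.
Qed.

Lemma dual_nullity_dual : dual_nullity (dual M) = nullity M.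
Proof. by rewrite /dual_nullity n_faces_dual /n_components components_dual. Qed.

Lemma component_genus_dual (C : {set dart M}) : C \in components M ->
  component_genus (M := dual M) C = component_genus C.
Proof.
move=> compC; rewrite /component_genus face_perm_dual.
rewrite -[X in (_ + 2 - (_ + X))./2]/(#|cycles_in (s ^ alpha)%g C|).
rewrite cycles_in_conj; last by move=> d; apply: in_component_edge.
by rewrite [X in (_ - X)%N]addnC.
Qed.

Lemma genus_product_dual (R : comNzRingType) (z : nat -> R) :
  genus_product z (dual M) = genus_product z M.
Proof.
rewrite /genus_product components_dual; congr (_ * _).
by apply: eq_bigr => C /component_genus_dual->.
Qed.

End Duality.

Lemma n_vertices_bound (M : surface_map) :
  (#|porbits (vertex_perm M)| <= n_edges M + #|components M|)%N.
Proof.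
rewrite -[X in (X <= _)%N]sum1_card -[n_edges M]sum1_card
  -[#|components M|]sum1_card.
rewrite (@big_cycles M _ _ _ (fun=> 1%N) _ _ (@component_of_vertex M)) //.
rewrite (@big_edges M _ _ _ (fun=> 1%N) false) -big_split /=;
  apply: leq_sum => C compC.
rewrite !sum1_card; have := Euler_component compC.
have : (0 < #|cycles_in (face_perm M) C|)%N.
  case/imsetP: (compC) => d _ defC; apply/card_gt0P;
    exists (porbit (face_perm M) d).
  rewrite inE imset_f //= porbit_sub_component //; first exact/eqP/esym.
  exact: component_of_face.
by move: #|_| #|_| #|_| => *; lia.
Qed.

Lemma genus_weight_sum (gT : finGroupType) (G : {group gT}) (v e f g : nat) :
    (v + f + 2 * g = e + 2)%N ->
  \sum_(i : Iirr G) (irr_dim i)%:R ^+ v * (irr_dim i)%:R ^+ f / (irr_dim i)%:R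
    ^+ e =
  - #|G|%:R * genus_weight G g.
Proof.
move=> Euler; rewrite /genus_weight mulrNN mulVKf ?neq0CG //.
apply: eq_bigr => i _; have n0 := irr_dim_neq0 i.
have -> : 2 - 2 * g%:Z = (v + f)%N%:Z - e%:Z by lia.
by rewrite expfzDr // -exprD -exprnP exprnN.
Qed.

Lemma genus_weight0 (gT : finGroupType) (G : {group gT}) : genus_weight G 0 =
  -1.
Proof.
rewrite /genus_weight mulr0 subr0; congr (- _).
suff -> : \sum_(i : Iirr G) (irr_dim i)%:R ^ (2 : int) = #|G|%:R :> algC.
  by rewrite mulVf ?neq0CG.
have := cfRegE G 1%g; rewrite cfReg_sum eqxx mulr1n sum_cfunE => <-.
by apply: eq_bigr => i _; rewrite cfunE -irrRepr cfRepr1 -exprnP expr2.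
Qed.

Lemma flows_evaluation (M : surface_map) (gT : finGroupType) (G : {group gT})
    (o : edge M -> bool) :
  (- #|G|%:R) ^+ nullity M * genus_product (genus_weight G) M =
  (-1) ^+ (n_edges M + n_vertices M) * #|flows G o|%:R :> algC.
Proof.
have G0 : #|G|%:R != 0 :> algC := neq0CG G.
have algebra (a g i k Q p e c : algC) : g * p = e * c -> k * k = 1 ->
    a * g * (i * Q) * p = a * i * k * (e * (k * c * Q)).
  move=> gp kk; have -> : a * g * (i * Q) * p = a * i * Q * (g * p) by ring.
  have -> : a * i * k * (e * (k * c * Q)) =
    a * i * Q * (e * c) * (k * k) by ring.
  by rewrite gp kk mulr1.
have := card_edge_potentials_components M G;
  rewrite (card_flows G o) natrM natrX.
rewrite (eq_bigr (fun C => - #|G|%:R * genus_weight G (component_genus C)));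
  last first.
  by move=> C /Euler_component/(@genus_weight_sum _ G).
rewrite big_split prodr_const /= => cardF.
have nullityE : (nullity M + #|porbits (vertex_perm M)| =
  n_edges M + #|components M|)%N.
  rewrite /nullity /n_components /n_vertices addnA subnDr subnK //.
  exact: n_vertices_bound.
rewrite /genus_product genus_weight0.
set P := \prod_(C in components M) _ in cardF *.
apply: (mulIf (expf_neq0 #|porbits (vertex_perm M)| G0)).
rewrite -[RHS]mulrA cardF exprNn.
have -> : (-1) ^+ (n_edges M + n_vertices M) =
    (-1) ^+ (nullity M + isolated M + #|components M|) :> algC.
  rewrite -signr_odd -[RHS]signr_odd; congr (_ ^+ nat_of_bool _).
  rewrite /n_vertices; move: nullityE;
    move: (nullity M) (n_edges M) (isolated M).
  by move: #|_| #|_| => *; lia.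
rewrite (exprNn #|G|%:R) !exprD.
have := congr1 (GRing.exp (#|G|%:R : algC)) nullityE; rewrite !exprD => Gnull.
have sgn : (-1) ^+ #|components M| * (-1) ^+ #|components M| = 1 :> algC.
  by rewrite -exprD addnn -mul2n exprM sqrrN !expr1n.
exact: algebra Gnull sgn.
Qed.

Lemma n_flows_inclusion_exclusion (M : surface_map) (gT : finGroupType)
    (G : {group gT}) (o : edge M -> bool) :
  (n_flows G o)%:R = \sum_(A : {set edge M})
    (-1) ^+ #|~: A| * #|flows G (kept_orientation (B := ~: A) o)|%:R :> algC.
Proof.
transitivity (\sum_(a in flows G o) \prod_e (1 + - (a e == 1%g)%:R) : algC).
  rewrite /n_flows -sum1_card natr_sum big_mkcond [RHS]big_mkcond.
  apply: eq_bigr => a _; rewrite !inE /=.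
  have [a_flow | _] := boolP (local_flow o a); rewrite ?andbF // !andbT.
  rewrite (eq_bigr (fun e => (a e != 1%g)%:R)) => [|e _]; last first.
    by case: eqP; rewrite ?subrr ?subr0.
  rewrite prod_bool; have -> : nowhere_identity G a = 
      [forall e, a e \in G] && [forall e, a e != 1%g].
    apply/forallP/andP => [aP | [/forallP aG /forallP a1] e].
      by split; apply/forallP => e; have := aP e; rewrite !inE => /andP[].
    by rewrite !inE a1 aG.
  by case: [forall e, a e \in G] => //=; case: [forall e, a e != 1%g].
rewrite (eq_bigr (fun a : {ffun edge M -> gT} => \sum_(A : {set edge M})
    (-1) ^+ #|~: A| * [forall e in ~: A, a e == 1%g]%:R)); last first.
  move=> a _; rewrite bigA_distr; apply: eq_bigr => A _.
  rewrite -prod_bool -prodr_const [X in _ = X * _]big_mkcond -big_split;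
    apply: eq_bigr => e _ /=.
  by rewrite inE; case: (e \in A); rewrite /= ?mulr1 ?mulN1r.
rewrite exchange_big; apply: eq_bigr => A _ /=; rewrite -mulr_sumr;
  congr (_ * _).
rewrite card_flows_delete -sum1dep_card natr_sum big_mkcondr /=.
by apply: eq_bigr => a _; case: [forall _ in _, _].
Qed.

Lemma genus_product1 (R : comNzRingType) M : genus_product (fun=> 1 : R) M = 1.
Proof. by rewrite /genus_product expr1n big1 ?mulr1. Qed.

Section SurfaceTutteEvaluation.

Variables (R : comNzRingType) (w : indet -> R).

Let evalM a b : eval w (a * b) = eval w a * eval w b.
Proof. exact: (rmorphM (eval w)). Qed.

Let evalX a n : eval w (a ^+ n) = eval w a ^+ n.
Proof. exact: (rmorphXn (eval w)). Qed.

Lemma eval_genus_product (z : nat -> indet) (M : surface_map) :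
  eval w (genus_product (fun g =>
    indeterminate (z g)) M) = genus_product (fun g => w (z g)) M.
Proof.
rewrite /genus_product evalM evalX eval_indeterminate; congr (_ * _).
rewrite (big_morph (eval w) evalM (rmorph1 (eval w))).
by apply: eq_bigr => C _; rewrite eval_indeterminate.
Qed.

Lemma eval_surface_tutte (M : surface_map) :
  eval w (surface_tutte M) =
  \sum_(A : {set edge M})
    w (inl None) ^+ dual_nullity (contract A) * w (inr None) ^+ nullity
      (delete (~: A)) *
    genus_product (fun g => w (inl (Some g))) (contract A) *
    genus_product (fun g => w (inr (Some g))) (delete (~: A)).
Proof.
rewrite /surface_tutte (big_morph (eval w) (rmorphD (eval w))
  (rmorph0 (eval w))).
have evalM4 a b c d : eval w (a * b * c * d) =
  eval w a * eval w b * eval w c * eval w d.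
  by rewrite (evalM (a * b * c)) (evalM (a * b)) (evalM a).
apply: eq_bigr => A _; apply: etrans (evalM4 _ _ _ _) _; congr (_ * _ * _ * _).
- by apply: etrans (evalX _ _) _; rewrite eval_indeterminate.
- by apply: etrans (evalX _ _) _; rewrite eval_indeterminate.
- exact: eval_genus_product (fun g => inl (Some g)) _.
- exact: eval_genus_product (fun g => inr (Some g)) _.
Qed.

End SurfaceTutteEvaluation.

Lemma n_flows_evaluation (M : surface_map) (gT : finGroupType) (G : {group gT})
    (o : edge M -> bool) :
  (n_flows G o)%:R = (-1) ^ ((n_edges M)%:Z - (n_vertices M)%:Z) *
    \sum_(A : {set edge M})
      (- #|G|%:R) ^+ nullity (delete (~: A)) * genus_product (genus_weight G)
        (delete (~: A)) :> algC.
Proof.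
rewrite n_flows_inclusion_exclusion mulr_sumr; apply: eq_bigr => A _.
rewrite (flows_evaluation G (kept_orientation o)) mulrA; congr (_ * _).
rewrite n_vertices_delete n_edges_delete setCK expfzDr ?oppr_eq0 ?oner_eq0 //.
rewrite -exprnP -exprnN.
have -> : ((-1) ^- n_vertices M = (-1) ^+ n_vertices M :>
  algC) by rewrite -exprVn invrN1.
rewrite -!exprD -[LHS]signr_odd -[RHS]signr_odd; congr (_ ^+ nat_of_bool _).
have := cardsC A; rewrite -/(n_edges M) => <-.
by move: #|_| #|_| => *; lia.
Qed.

Theorem theorem4p2 (M : surface_map) (gT : finGroupType) (G : {group gT})
    (o : edge M -> bool) :
  ((n_tensions G o)%:R =
     (-1) ^ ((n_edges M)%:Z - (n_faces M)%:Z) *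
     eval (valuation (- #|G|%:R) 1 (genus_weight G) (fun=> 1))
          (surface_tutte M) :> algC) /\
  ((n_flows G o)%:R =
     (-1) ^ ((n_edges M)%:Z - (n_vertices M)%:Z) *
     eval (valuation 1 (- #|G|%:R) (fun=> 1) (genus_weight G))
          (surface_tutte M) :> algC).
Proof.
split; rewrite eval_surface_tutte; last first.
  rewrite n_flows_evaluation; congr (_ * _); apply: eq_bigr => A _.
  by rewrite expr1n mul1r genus_product1 mulr1.
rewrite (_ : n_tensions G o = n_flows (M := dual M) G o) //.
rewrite n_flows_evaluation; congr (_ * _).
rewrite (reindex_inj (@setC_inj _)); apply: eq_bigr => A _ /=.
by rewrite setCK expr1n mulr1 genus_product1 mulr1 dual_nullity_dual
  genus_product_dual.
Qed.
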